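(* Let $q$ be a prime power and let $n,d,\ell$ be positive integers with $\ell\ge n$. Then $$A_q^{\mathrm{Lin}}(n,d)=\mathrm{val}\big(\mathrm{PartialKrawtchoukLP}_{\mathrm{Lin}}^{\mathbb{F}_q}(n,d,\ell)\big).$$
   Context: $\mathbb{F}_q$ is the finite field with $q$ elements. For $w\in\mathbb{F}_q^n$, $|w|$ is the Hamming weight (number of nonzero coordinates), and $[d-1]=\{1,\dots,d-1\}$. A linear code of blocklength $n$ is a linear subspace $\mathcal{C}\le\mathbb{F}_q^n$; it has minimum distance at least $d$ if no $w\in\mathcal{C}$ has $|w|\in[d-1]$ (the zero code satisfies this vacuously). $A_q^{\mathrm{Lin}}(n,d)$ is the maximum cardinality of a linear code $\mathcal{C}\le\mathbb{F}_q^n$ of minimum distance at least $d$. For $\alpha\in\mathbb{F}_q^n$, $\chi_\alpha\colon\mathbb{F}_q^n\to\mathbb{C}$ is the additive character associated with $\alpha$, $\chi_\alpha(x)=\exp\big(2\pi i\,\mathrm{Tr}_{\mathbb{F}_q/\mathbb{F}_p}(\sum_k\alpha_kx_k)/p\big)$, where $p$ is the characteristic of $\mathbb{F}_q$, and $\mathbf{1}_\alpha\colon\mathbb{F}_q^n\to\{0,1\}$ is the indicator function of the point $\alpha$. $\mathrm{PartialKrawtchoukLP}_{\mathrm{Lin}}^{\mathbb{F}_q}(n,d,\ell)$ is the following linear program in real variables $a_x$, $x\in(\mathbb{F}_q^n)^\ell$: maximize $\sum_{x_1\in\mathbb{F}_q^n}a_{(x_1,0,\dots,0)}$ subject to (1)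 $a_0=1$; (2) $a_{(x_1,\dots,x_\ell)}=0$ whenever there is $w\in\mathrm{span}(x_1,\dots,x_\ell)$ with $|w|\in[d-1]$; (3) (partial Fourier) $\sum_{x\in(\mathbb{F}_q^n)^\ell}a_x\theta_\alpha(x)\ge0$ for all $\alpha=(\alpha_1,\dots,\alpha_\ell)\in(\mathbb{F}_q^n)^\ell$ and all functions of the form $\theta_\alpha(x)=\prod_{i=1}^\ell\theta_{\alpha_i}(x_i)$ in which each $\theta_{\alpha_i}$ is chosen (independently for each index $i$) from $\{\chi_{\alpha_i},\mathbf{1}_{\alpha_i}\}$; (4) $a_x=a_y$ for all $x,y\in(\mathbb{F}_q^n)^\ell$ with $\mathrm{span}(x)=\mathrm{span}(y)$, where $\mathrm{span}(x)=\mathrm{span}(x_1,\dots,x_\ell)$; (5) $a_x\ge0$ for all $x\in(\mathbb{F}_q^n)^\ell$. $\mathrm{val}(\cdot)$ denotes the optimum value of a linear program. *)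

(* Defs.v *)
From mathcomp Require Import all_boot all_order all_algebra all_field.
From mathcomp Require Import all_classical all_reals all_analysis.
From mathcomp Require Import complex.

Set Implicit Arguments.
Unset Strict Implicit.
Unset Printing Implicit Defensive.

Import Order.TTheory GRing.Theory Num.Theory.

Local Open Scope ring_scope.
Local Open Scope complex_scope.

Section Codes.
Variables (F : finFieldType) (n : nat).

Definition hweight (w : 'rV[F]_n) : nat := #|[set k | w 0 k != 0]|.

Definition mindist_ge (d : nat) (C : {set 'rV[F]_n}) : bool :=
  [forall w in C, ~~ (0 < hweight w < d)%N].

(* Codes are represented as finite sets, so that the maximum of their
   cardinalities is a finite \max; {vspace 'rV[F]_n} is not a finType. *)
Definition linear_code (C : {set 'rV[F]_n}) : bool := `[< submod_closed C >].

Definition ALin (d : nat) : nat :=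
  \max_(C : {set 'rV[F]_n} | linear_code C && mindist_ge d C) #|C|.

End Codes.

Section Characters.
Variable F : finFieldType.

Definition fchar : nat := s2val (finPcharP F).

Definition fchar_pchar : fchar \in [pchar F] := s2valP' (finPcharP F).

(* F viewed as an extension of its prime field 'F_p. *)
Definition overFp : splittingFieldType 'F_fchar := pPrimeCharType fchar_pchar.

(* galTrace takes its values in the prime subfield, regarded as a line of
   overFp with basis 1; its coordinate there is the trace as an element
   of 'F_p. *)
Definition trFp (x : F) : 'F_fchar :=
  coord [tuple (1 : overFp)] ord0 (galTrace 1%AS {:overFp}%AS (x : overFp)).

Variables (R : realType) (n : nat).

(* cis t = exp (i t) *)
Definition cis (t : R) : R[i] := cos t +i* sin t.

Definition chi (alpha x : 'rV[F]_n) : R[i] :=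
  cis (2 * pi * (trFp (\sum_k alpha 0 k * x 0 k) : nat)%:R / fchar%:R).

Definition point_ind (alpha x : 'rV[F]_n) : R[i] := (x == alpha)%:R.

End Characters.

(* The optimum of a maximization problem is taken in \bar R: it is -oo if the
   problem is infeasible and +oo if it is unbounded. *)
Record max_problem (R : realType) (V : Type) := MaxProblem {
  objective : V -> R;
  feasible : set V }.

Definition val_max (R : realType) (V : Type) (P : max_problem R V) : \bar R :=
  ereal_sup [set (objective P a)%:E | a in feasible P]%classic.

Section PartialKrawtchoukLP.
Variables (R : realType) (F : finFieldType) (n d l : nat).

Local Notation W := 'rV[F]_n.
Local Notation config := {ffun 'I_l -> W}.

Definition cspan (x : config) : {vspace W} := <<codom x>>%VS.

Definition first_only (x1 : W) : config :=
  [ffun i : 'I_l => if i == 0%N :> nat then x1 else 0].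

Definition partial_fourier (a : config -> R) : Prop :=
  forall (alpha : config) (theta : 'I_l -> W -> R[i]),
    (forall i, theta i = chi R (alpha i) \/ theta i = point_ind R (alpha i)) ->
    (* the order of R[i]: the sum is real and nonnegative *)
    0 <= \sum_(x : config) (a x)%:C * \prod_(i < l) theta i (x i).

Record PartialKrawtchouk_feasible (a : config -> R) : Prop := {
  pk_normalized : a [ffun=> 0] = 1;
  pk_distance : forall x : config,
    (exists2 w : W, w \in cspan x & (0 < hweight w < d)%N) -> a x = 0;
  pk_fourier : partial_fourier a;
  pk_span : forall x y : config, cspan x = cspan y -> a x = a y;
  pk_nonneg : forall x : config, 0 <= a x }.

Definition PartialKrawtchoukLP_Lin : max_problem R (config -> R) :=
  MaxProblem (fun a => \sum_(x1 : W) a (first_only x1))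
             [set a | PartialKrawtchouk_feasible a]%classic.

End PartialKrawtchoukLP.

(* Main.v *)
(* Since l >= n, every code is the span of a configuration, so a feasible a is
   a function of the span, and Moebius inversion on the lattice of codes gives
   a x = \sum_C m C over the codes C containing all x_i.  The partial Fourier
   constraint forces m >= 0; hence a C = 0 forces m C = 0 when C has small
   distance, a 0 = 1 forces \sum_C m C = 1, and the objective \sum_C m C * #|C|
   is an average of sizes of codes of distance at least d.  Conversely the
   indicator of the configurations contained in an optimal code is feasible. *)
Require Import Defs.
From mathcomp Require Import all_boot all_order all_algebra all_field.
From mathcomp Require Import all_classical all_reals all_analysis.
From mathcomp Require Import complex ring.

Set Implicit Arguments.
Unset Strict Implicit.
Unset Printing Implicit Defensive.

Import Order.TTheory GRing.Theory Num.Theory.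
Local Open Scope ring_scope.

(** * The trace to the prime field *)

Section Trace.
Variable F : finFieldType.

Lemma fchar_prime : prime (fchar F).
Proof. exact: (s2valP (finPcharP F)). Qed.

Lemma trFpD (x y : F) : trFp (x + y) = trFp x + trFp y.
Proof. by rewrite /trFp (raddfD (galTrace _ _)) linearD. Qed.

(* A vanishing trace would be a linear relation between the Galois
   automorphisms, which are linearly independent. *)
Lemma trFp_nontrivial : exists x : F, trFp x != 0.
Proof.
apply: contrapT => noX.
(* The Galois trace lies in the line spanned by 1, so it vanishes together with its coordinate
   [trFp]. *)
have tr0 (a : overFp F) : galTrace 1%AS {:overFp F}%AS a = 0.
  have /vlineP[k ak] :=
    mem_galTrace (finField_galois (sub1v {:overFp F}%AS)) (memvf a).
  have : trFp (a : F) = 0.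
    by case: (eqVneq (trFp (a : F)) 0) => [//|nz]; case: noX; exists (a : F).
  have free1 : free [tuple (1 : overFp F)] by rewrite seq1_free oner_neq0.
  rewrite /trFp ak linearZ /= => /eqP; rewrite mulf_eq0 => /orP[/eqP->|].
    by rewrite scale0r.
  by have /= -> := coord_free ord0 ord0 free1.
have /eqP := gal_independent (P := mem 'Gal({:overFp F} / 1)%g)
  (c_ := fun=> 1)
  (fun a _ => etrans (eq_bigr _ (fun x _ => mul1r _)) (tr0 a))
  (fingroup.group1 _).
by rewrite oner_eq0.
Qed.

Lemma trFp_scale_nontrivial (y : F) : y != 0 -> exists c, trFp (c * y) != 0.
Proof.
move=> y0; have [x hx] := trFp_nontrivial.
by exists (x / y); rewrite divfK.
Qed.

End Trace.

(** * Additive characters and their sums over a code *)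

Section Chi.
Variables (R : realType) (F : finFieldType) (n : nat).
Local Notation W := 'rV[F]_n.
Local Notation dot u v := (\sum_k u 0 k * v 0 k).
Local Notation p := (fchar F).

Lemma cisD (s t : R) : cis (s + t) = cis s * cis t.
Proof. by rewrite /cis cosD sinD [X in (_ +i* X)%C]addrC. Qed.

Lemma cis0 : cis (0 : R) = 1.
Proof. by rewrite /cis cos0 sin0. Qed.

Lemma cisMn (t : R) k : cis (t *+ k) = cis t ^+ k.
Proof. by elim: k => [|k IH]; rewrite ?cis0 // mulrS cisD IH exprS. Qed.

Lemma cis2pi : cis (pi *+ 2 : R) = 1.
Proof. by rewrite /cis cos2pi mulr2n sinDpi sinpi oppr0. Qed.

(** The real parts already differ: 1 - cos t = 2 sin^2 (t/2), and t/2 lies strictly between 0 and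
    pi. *)
Lemma cis_neq1 (t : R) : 0 < t < pi *+ 2 -> cis t != 1.
Proof.
move=> /andP[t0 t2]; apply/eqP => -[/eqP + _]; apply/negP.
have s0 : 0 < sin (t / 2).
  apply: sin_gt0_pi; rewrite divr_gt0 //=.
  by rewrite ltr_pdivrMr // mulr_natr.
have -> : t = (t / 2) *+ 2 by rewrite -mulr_natr divfK // pnatr_eq0.
rewrite cos_mulr2n cos2sin2 mulrnBl -subr_eq0 mulr2n opprD !addrA.
rewrite (_ : _ - 1 = - (sin (t / 2) ^+ 2 *+ 2)); last by ring.
by rewrite oppr_eq0 mulrn_eq0 /= sqrf_eq0 gt_eqF.
Qed.

Lemma fchar_natr_gt0 : 0 < p%:R :> R.
Proof. by rewrite ltr0n prime_gt0 // fchar_prime. Qed.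

Definition zeta : R[i] := cis (pi *+ 2 / p%:R).

Lemma chiE (alpha x : W) : chi R alpha x = zeta ^+ (trFp (dot alpha x) : nat).
Proof.
rewrite /chi /zeta -cisMn; congr cis.
by rewrite -mulr_natr; ring.
Qed.

Lemma zeta_order : zeta ^+ p = 1.
Proof.
rewrite /zeta -cisMn -[_ *+ fchar F]mulr_natr divfK ?cis2pi //.
by rewrite gt_eqF // fchar_natr_gt0.
Qed.

(** Addition in ['F_p] reduces modulo [p], which an exponent of a [p]-th root of unity does not
    see. *)
Lemma zetaD (a b : 'F_p) : zeta ^+ (a + b)%R = zeta ^+ a * zeta ^+ b.
Proof.
rewrite (_ : nat_of_ord _ = ((a + b) %% p)%N); last first.
  by rewrite /= {3}Fp_cast ?fchar_prime.
by rewrite expr_mod ?exprD ?zeta_order.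
Qed.

Lemma zeta_neq1 (a : 'F_p) : a != 0 -> zeta ^+ a != 1.
Proof.
move=> a0; rewrite /zeta -cisMn; apply: cis_neq1.
have a_gt0 : (0 < a)%N by rewrite lt0n.
have a_ltp : (a < p)%N by rewrite -{2}(Fp_cast (fchar_prime F)) ltn_ord.
have pi2 : 0 < pi *+ 2 :> R by rewrite pmulrn_lgt0 // pi_gt0.
rewrite pmulrn_lgt0 // divr_gt0 ?fchar_natr_gt0 //=.
rewrite -[_ *+ a]mulr_natr mulrAC ltr_pdivrMr ?fchar_natr_gt0 //.
by rewrite (ltr_pM2l pi2) ltr_nat.
Qed.

Lemma chiDr (alpha x y : W) : chi R alpha (x + y) = chi R alpha x * chi R alpha y.
Proof.
rewrite !chiE -zetaD -trFpD; congr (_ ^+ trFp _).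
by rewrite -big_split /=; apply: eq_bigr => k _; rewrite mxE mulrDr.
Qed.

Lemma chi_eq1 (alpha x : W) : dot alpha x = 0 -> chi R alpha x = 1.
Proof.
move=> ax; rewrite chiE ax.
have -> : trFp (0 : F) = 0.
  by apply: (addrI (trFp (0 : F))); rewrite -trFpD !addr0.
by rewrite expr0.
Qed.

Variable C : {set W}.
Hypothesis linC : linear_code C.

Lemma linear_code0 : 0 \in C.
Proof. by move/asboolP: linC => -[]. Qed.

Lemma linear_codeZ c x : x \in C -> c *: x \in C.
Proof. by move/asboolP: linC => [h0 h] xC; rewrite -[_ *: _]addr0 h. Qed.

Lemma linear_codeD x y : x \in C -> y \in C -> x + y \in C.
Proof. by move/asboolP: linC => [h0 h] xC yC; rewrite -[x]scale1r h. Qed.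

Lemma linear_code_sum (I : Type) (r : seq I) (P : pred I) (f : I -> W) :
  (forall i, P i -> f i \in C) -> \sum_(i <- r | P i) f i \in C.
Proof.
move=> fC; apply: (big_ind (fun v => v \in C)) => //.
  exact: linear_code0.
exact: linear_codeD.
Qed.

(** Orthogonality of characters: translation by a word of [C] permutes [C] and multiplies the sum by
    the character value at that word; if some value is not 1, the sum is 0. *)
Lemma sum_chi_code (alpha : W) :
  \sum_(v in C) chi R alpha v =
    if [forall v in C, dot alpha v == 0] then #|C|%:R else 0.
Proof.
case: ifPn => [/forall_inP h | ].
  rewrite (eq_bigr (fun _ => 1)) ?sumr_const // => v vC.
  by apply: chi_eq1; apply/eqP/h.
rewrite negb_forall => /existsP[v]; rewrite negb_imply => /andP[vC av].
(* The trace of a nonzero product [dot alpha v] may still be 0; a suitable multiple of [v] avoids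
   this. *)
have [c hc] := trFp_scale_nontrivial av.
have cvC : c *: v \in C := linear_codeZ c vC.
have E : \sum_(v in C) chi R alpha v =
         chi R alpha (c *: v) * \sum_(v in C) chi R alpha v.
  rewrite mulr_sumr (reindex_inj (addrI (c *: v))) /=.
  apply: eq_big => [u|u _]; last by rewrite chiDr.
  apply/idP/idP => uC; last exact: linear_codeD.
  have -> : u = (-1) *: (c *: v) + (c *: v + u) by rewrite scaleN1r addKr.
  exact: linear_codeD (linear_codeZ _ cvC) uC.
apply/eqP; move/eqP: E; rewrite -subr_eq0 -{1}[\sum_(v in C) _]mul1r -mulrBl.
rewrite mulf_eq0 subr_eq0 eq_sym => /orP[|//]; apply: contraTT => _.
rewrite chiE; apply: zeta_neq1; rewrite (_ : dot _ _ = c * dot alpha v) //.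
by rewrite mulr_sumr; apply: eq_bigr => k _; rewrite mxE mulrCA.
Qed.

Lemma sum_point_ind_code (alpha : W) :
  \sum_(v in C) point_ind R alpha v = (alpha \in C)%:R.
Proof.
rewrite /point_ind; case: (boolP (alpha \in C)) => aC.
  rewrite (bigD1 alpha) //= eqxx big1 ?addr0 // => v /andP[_ /negPf->].
  exact: mulr0n.
by rewrite big1 // => v vC; case: eqP => // ev; rewrite -ev vC in aC.
Qed.

End Chi.

(** * Bases of a code and of its dual, and inversion over supersets *)

Section LinearCodes.
Variables (F : finFieldType) (n : nat).
Local Notation W := 'rV[F]_n.
Local Notation dot u v := (\sum_k u 0 k * v 0 k).

Lemma span_sub_code (C : {set W}) (s : seq W) :
  linear_code C -> {subset s <= C} -> forall w, w \in span s -> w \in C.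
Proof.
move=> linC sC w ws; rewrite (coord_span (X := in_tuple s) ws).
apply: (linear_code_sum linC) => i _; apply: (linear_codeZ linC).
exact/sC/mem_nth.
Qed.

Lemma dot_mulmx m (A : 'M[F]_(m, n)) (v : W) i :
  (A *m v^T) i 0 = dot (row i A) v.
Proof. by rewrite mxE; apply: eq_bigr => k _; rewrite !mxE. Qed.

(** Here [s] is a basis of [C] and [t] one of its dual code; their dimensions add up to [n], so both
    lists fit into [l >= n] slots. *)
Lemma code_bases (C : {set W}) : linear_code C ->
  exists s t : seq W,
    [/\ (size s + size t <= n)%N, {subset s <= C},
        forall v, v \in C -> v \in span s
      & forall v, v \in C <-> (forall u, u \in t -> dot u v = 0)].
Proof.
(* The rows of [M] are all the words of [C], so its row space is [C]; the transposed cokernel spans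
   the dual code. *)
move=> linC; pose M : 'M[F]_(#|C|, n) := \matrix_(i < #|C|) enum_val i.
have memM v : (v <= M)%MS = (v \in C).
  apply/idP/idP => [/submxP[u ->]|vC].
    rewrite mulmx_sum_row; apply: (linear_code_sum linC) => i _.
    by apply: (linear_codeZ linC); rewrite rowK enum_valP.
  by rewrite -(enum_rankK_in vC vC) -(rowK (fun i => enum_val i)) row_sub.
pose B := row_base M; pose K := row_base (cokermx M)^T.
exists (codom (fun i => row i B)).
exists (codom (fun i => row i K)).
split.
- rewrite !size_codom !card_ord mxrank_tr mxrank_coker.
  by rewrite subnKC ?rank_leq_col.
- move=> _ /codomP[i ->]; rewrite -memM.
  by apply: submx_trans (row_sub _ _) _; rewrite eq_row_base.
- move=> v; rewrite -memM -(eq_row_base M) => /submxP[u ->].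
  rewrite mulmx_sum_row; apply: memv_suml => i _; apply/memvZ/memv_span.
  exact: (codom_f (fun i => row i _)).
- move=> v; rewrite -memM submxE.
  have -> : (v *m cokermx M == 0) = ((cokermx M)^T *m v^T == 0).
    by rewrite -trmx_mul -(inj_eq trmx_inj) trmx0.
  split=> [/eqP vM0 _ /codomP[i ->]|vt].
    have /submxP[X KX] : (K <= (cokermx M)^T)%MS by rewrite eq_row_base.
    by rewrite -dot_mulmx KX -mulmxA vM0 mulmx0 mxE.
  have /submxP[X ->] : ((cokermx M)^T <= K)%MS by rewrite eq_row_base.
  rewrite -mulmxA (_ : K *m v^T = 0) ?mulmx0 //.
  apply/matrixP => i j; rewrite ord1 dot_mulmx mxE; apply: vt.
  exact: (codom_f (fun i => row i _)).
Qed.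

End LinearCodes.

(** The value of [m] at a set is determined by its values at the proper supersets, so [m] is built
    from large sets down to small ones. *)
Lemma moebius_superset (T : finType) (V : zmodType) (P : pred {set T})
    (g : {set T} -> V) :
  exists m : {set T} -> V,
    forall A, P A -> g A = \sum_(B | P B && (A \subset B)) m B.
Proof.
(* At stage [k] the formula holds for the sets with more than [#|T| - k] elements. *)
suff /(_ #|T|.+1)[m mP] : forall k, exists m : {set T} -> V, forall A, P A ->
    (#|T| < #|A| + k)%N -> g A = \sum_(B | P B && (A \subset B)) m B.
  by exists m => A PA; apply: mP => //; rewrite addnS ltnS leq_addl.
elim=> [|k [m IH]].
  by exists (fun=> 0) => A _; rewrite addn0 ltnNge max_card.
pose m' (A : {set T}) := if (#|T| < #|A| + k)%N then m A
             else g A - \sum_(B | P B && (A \proper B)) m B.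
exists m' => A PA; rewrite addnS ltnS => Ak.
case: (ltnP #|T| (#|A| + k)) => [Alt|Age].
  rewrite (IH A PA Alt); apply: eq_bigr => B /andP[_ AB].
  by rewrite /m' (leq_trans Alt) // leq_add2r subset_leq_card.
rewrite (bigD1 A) ?PA ?subxx //= {1}/m' ltnNge Age /=.
rewrite [X in _ + X](_ : _ = \sum_(B | P B && (A \proper B)) m B) ?subrK //.
apply: eq_big => [B|B /andP[/andP[_ AB] BA]].
  by rewrite finset.properEneq eq_sym -andbA [(A \subset B) && _]andbC.
rewrite /m' (leq_ltn_trans Ak) // ltn_add2r proper_card //.
by rewrite finset.properEneq eq_sym BA.
Qed.

(** * Functions of the span as mixtures of codes *)

Section Decomposition.
Variables (R : realType) (F : finFieldType) (n l : nat).
Local Notation W := 'rV[F]_n.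
Local Notation config := {ffun 'I_l -> W}.

Definition config_in (x : config) (C : {set W}) := [forall i, x i \in C].

Definition code_mixture (a : config -> R) (m : {set W} -> R) :=
  forall x, a x = \sum_(C | linear_code C && config_in x C) m C.

Lemma config_in_cspan x C : linear_code C ->
  config_in x C = ([set w | w \in cspan x] \subset C).
Proof.
move=> linC; apply/forallP/fintype.subsetP => [xC w|sC i].
  by rewrite inE; apply: (span_sub_code linC) => _ /codomP[i ->].
by apply: sC; rewrite inE memv_span // codom_f.
Qed.

Lemma linear_code_vspace (U : {vspace W}) : linear_code [set w | w \in U].
Proof.
apply/asboolP; split=> [|c u v]; rewrite ?inE ?mem0v // => uU vU.
by rewrite memvD ?memvZ.
Qed.

Lemma code_eq_cspan C : (n <= l)%N -> linear_code C ->
  exists x : config, [set w | w \in cspan x] = C.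
Proof.
move=> nl linC; have [s [t [st sC Cs _]]] := code_bases linC.
(* The slots after the basis hold the default 0, which adds nothing to the span. *)
exists [ffun i : 'I_l => nth 0 s i].
apply/finset.setP => w; rewrite inE; apply/idP/idP => [|/Cs].
  apply: (span_sub_code linC) => _ /codomP[i ->]; rewrite ffunE.
  case: (ltnP i (size s)) => si; first exact/sC/mem_nth.
  by rewrite nth_default // linear_code0.
apply: subvP; apply/span_subvP => u us; apply: memv_span.
have il : (index u s < l)%N.
  rewrite (leq_trans _ nl) // (leq_trans _ st) // ltn_addr //.
  by rewrite index_mem.
by apply/codomP; exists (Ordinal il); rewrite ffunE nth_index.
Qed.

Lemma exists_code_mixture (a : config -> R) : (n <= l)%N ->
  (forall x y, cspan x = cspan y -> a x = a y) -> exists m, code_mixture a m.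
Proof.
move=> nl aspan.
(* [gen] picks a configuration spanning each code, which turns [a] into a function of codes. *)
have [C|gen genP] := @choice {set W} config
    (fun C x => linear_code C -> [set w | w \in cspan x] = C).
  case: (pselect (linear_code C)) => [linC|]; last by exists [ffun=> 0].
  by have [x xC] := code_eq_cspan nl linC; exists x.
have [m mP] := moebius_superset (@linear_code F n) (fun C => a (gen C)).
exists m => x; have linx := linear_code_vspace (cspan x).
rewrite (aspan x (gen [set w | w \in cspan x])) ?mP //.
  by apply: eq_bigl => C; case: (boolP (linear_code C)) => //= /config_in_cspan->.
apply/vspaceP => w.
by move/finset.setP/(_ w): (genP _ linx); rewrite !inE.
Qed.

(** Each code contributes a sum of a product function over the power [C^l], which factors into one
    sum over [C] per coordinate. *)
Lemma fourier_mixture (a : config -> R) m (theta : 'I_l -> W -> R[i]) :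
  code_mixture a m ->
  \sum_x (a x)%:C%C * \prod_(i < l) theta i (x i) =
  \sum_(C | linear_code C) (m C)%:C%C * \prod_(i < l) \sum_(v in C) theta i v.
Proof.
move=> am.
under eq_bigr do rewrite am rmorph_sum mulr_suml.
rewrite (exchange_big_dep (@linear_code F n)) => [|x C _ /andP[] //].
apply: eq_bigr => C linC; rewrite bigA_distr_big /= -mulr_sumr; congr (_ * _).
by apply: eq_bigl => x; rewrite linC; apply: eq_forallb => i.
Qed.

(** As 0 is in [C], the configuration [first_only x1] lies in [C] exactly when [x1] does, so [m C]
    is counted once per word. *)
Lemma objective_mixture d (a : config -> R) m : (0 < l)%N -> code_mixture a m ->
  objective (PartialKrawtchoukLP_Lin R F n d l) a =
  \sum_(C | linear_code C) m C * #|C|%:R.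
Proof.
move=> l0 am /=.
under eq_bigr do rewrite am.
rewrite (exchange_big_dep (@linear_code F n)) => [|x C _ /andP[] //].
apply: eq_bigr => C linC /=; rewrite mulr_natr -sumr_const.
apply: eq_bigl => x; rewrite linC /=; apply/forallP/idP => [/(_ (Ordinal l0))|xC i].
  by rewrite ffunE.
by rewrite ffunE; case: ifP => // _; apply: linear_code0.
Qed.

(* With indicators at a basis of C and characters at a basis of its dual code,
   C is the only code whose term survives in the Fourier sum. *)
Lemma mixture_ge0 (a : config -> R) m C : (n <= l)%N ->
  partial_fourier a -> code_mixture a m -> linear_code C -> 0 <= m C.
Proof.
move=> nl afour am linC.
have [s [t [st sC Cs Ct]]] := code_bases linC.
pose alpha : config := [ffun i : 'I_l => nth 0 (s ++ t) i].
pose theta (i : 'I_l) :=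
  if (i < size s)%N then @point_ind F R n (alpha i) else chi R (alpha i).
have theta_sum D i : linear_code D -> \sum_(v in D) theta i v =
    if (i < size s)%N then (alpha i \in D)%:R
    else if [forall v in D, \sum_k alpha i 0 k * v 0 k == 0] then #|D|%:R else 0.
  move=> linD; rewrite /theta; case: ifP => _; last exact: sum_chi_code.
  exact: sum_point_ind_code.
have theta_ok i : theta i = chi R (alpha i) \/ theta i = @point_ind F R n (alpha i).
  by rewrite /theta; case: ifP; [right|left].
have := afour alpha theta theta_ok; rewrite (fourier_mixture _ am).
rewrite (bigD1 C) //= [X in _ + X]big1 ?addr0 => [|D /andP[linD DC]]; last first.
  (* If no factor vanished, [D] would be orthogonal to [t], hence inside [C], and would contain [s],
     hence all of [C]. *)
  have [i i0] : exists i, \sum_(v in D) theta i v = 0.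
    apply: contrapT => /forallNP nz; case/eqP: DC; apply/eqP.
    rewrite finset.eqEsubset; apply/andP; split; apply/fintype.subsetP => v vX.
      apply/Ct => u ut.
      have il : (size s + index u t < l)%N.
        rewrite (leq_trans _ nl) // (leq_trans _ st) // ltn_add2l.
        by rewrite index_mem.
      have := nz (Ordinal il); rewrite theta_sum // ltnNge leq_addr /=.
      rewrite ffunE nth_cat /= ltnNge leq_addr addKn nth_index //=.
      by case: ifP => [/forall_inP/(_ v vX)/eqP|//].
    apply: (span_sub_code linD _ (Cs v vX)) => u us.
    have uls : (index u s < size s)%N by rewrite index_mem.
    have il : (index u s < l)%N.
      by rewrite (leq_trans uls) // (leq_trans _ nl) // (leq_trans _ st) // leq_addr.
    have := nz (Ordinal il); rewrite theta_sum // uls ffunE nth_cat /= uls nth_index //.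
    by case: (u \in D) => // /(_ erefl).
  by rewrite (bigD1 i) //= i0 mul0r mulr0.
(* For [C] itself each indicator gives 1 and each character gives [#|C|]; the slots beyond both
   bases carry the trivial character. *)
have [N N0 ->] : exists2 N, (0 < N)%N &
    \prod_(i < l) \sum_(v in C) theta i v = N%:R.
  exists (\prod_(i < l) (if (i < size s)%N then 1 else #|C|))%N.
    rewrite prodn_gt0 // => i; case: ifP => // _.
    by apply/card_gt0P; exists 0; apply: linear_code0.
  rewrite natr_prod; apply: eq_bigr => i _; rewrite theta_sum // ffunE nth_cat.
  case: (ltnP i (size s)) => si; first by rewrite sC ?mem_nth.
  rewrite ifT //; apply/forall_inP => v vC; apply/eqP.
  case: (ltnP (i - size s) (size t)) => it.
    by move/Ct: vC; apply; apply: mem_nth.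
  by rewrite nth_default // big1 // => k _; rewrite mxE mul0r.
by rewrite pmulr_lge0 ?ltr0n // ler0c.
Qed.

End Decomposition.

(** * Both inequalities between the optimum and the code size *)

Section Optimum.
Variables (R : realType) (F : finFieldType) (n d l : nat).
Local Notation W := 'rV[F]_n.
Local Notation config := {ffun 'I_l -> W}.
Hypothesis l_gt0 : (0 < l)%N.

Definition code_indicator (C : {set W}) (x : config) : R := (config_in x C)%:R.

Lemma code_indicator_mixture C : linear_code C ->
  code_mixture (code_indicator C) (fun D => (D == C)%:R).
Proof.
move=> linC x; rewrite /code_indicator; case: (boolP (config_in x C)) => xC.
  rewrite (bigD1 C) ?linC //= eqxx big1 ?addr0 // => D /andP[_ /negPf->].
  exact: mulr0n.
rewrite big1 // => D /andP[_ xD]; case: eqP => // DC.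
by rewrite -DC xD in xC.
Qed.

(** For the Fourier constraint, every factor is a sum over a code of a character or a point
    indicator, hence a natural number. *)
Lemma code_indicator_feasible C : linear_code C -> mindist_ge d C ->
  PartialKrawtchouk_feasible d (code_indicator C).
Proof.
move=> linC Cd; split.
- rewrite /code_indicator (_ : config_in _ _) //.
  by apply/forallP => i; rewrite ffunE linear_code0.
- move=> x [w wx wd]; rewrite /code_indicator.
  case: (boolP (config_in x C)) => //; rewrite config_in_cspan // => /fintype.subsetP xC.
  have wC : w \in C by apply: xC; rewrite inE.
  by move/forall_inP/(_ w wC): Cd; rewrite wd.
- move=> alpha theta theta_def.
  rewrite (fourier_mixture _ (code_indicator_mixture linC)).
  apply: sumr_ge0 => D linD; rewrite mulr_ge0 ?ler0c //.
  apply: prodr_ge0 => i _; case: (theta_def i) => ->.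
    by rewrite sum_chi_code //; case: ifP.
  by rewrite sum_point_ind_code.
- by move=> x y xy; rewrite /code_indicator !config_in_cspan // xy.
- by move=> x; rewrite /code_indicator.
Qed.

Lemma code_indicator_objective C : linear_code C ->
  objective (PartialKrawtchoukLP_Lin R F n d l) (code_indicator C) = #|C|%:R.
Proof.
move=> linC; rewrite (objective_mixture _ l_gt0 (code_indicator_mixture linC)).
rewrite (bigD1 C) //= eqxx mul1r big1 ?addr0 // => D /andP[_ /negPf->].
by rewrite mul0r.
Qed.

Lemma objective_le_ALin (a : config -> R) : (n <= l)%N ->
  PartialKrawtchouk_feasible d a ->
  objective (PartialKrawtchoukLP_Lin R F n d l) a <= (ALin F n d)%:R.
Proof.
move=> nl [a0 adist afour aspan _].
have [m am] := exists_code_mixture nl aspan.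
have m_ge0 := mixture_ge0 nl afour am.
(* At a configuration spanning [C], [a] is 0 and is a sum of nonnegative terms, one of them
   [m C]. *)
have m_bad C : linear_code C -> ~~ mindist_ge d C -> m C = 0.
  move=> linC /forallPn[w]; rewrite negb_imply negbK => /andP[wC wd].
  have [x xC] := code_eq_cspan nl linC.
  have x_in_C : config_in x C by rewrite config_in_cspan // xC subxx.
  have : a x = 0 by apply: adist; exists w => //; rewrite -xC inE in wC.
  rewrite am => /eqP; rewrite psumr_eq0 => [/allP|D /andP[linD _]]; last exact: m_ge0.
  by move=> /(_ C (mem_index_enum _)); rewrite linC x_in_C => /eqP.
(* Every code contains the zero configuration. *)
have m_sum1 : \sum_(C | linear_code C) m C = 1.
  rewrite -a0 am; apply: eq_bigl => C.
  case: (boolP (linear_code C)) => //= linC.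
  by symmetry; apply/forallP => i; rewrite ffunE linear_code0.
rewrite (objective_mixture _ l_gt0 am) -[leRHS]mul1r.
rewrite -[X in _ <= X * _]m_sum1 mulr_suml.
apply: ler_sum => C linC.
case: (boolP (mindist_ge d C)) => Cd; last by rewrite m_bad // !mul0r.
apply: ler_wpM2l; first exact: m_ge0.
by rewrite ler_nat /ALin (leq_bigmax_cond C) // linC.
Qed.

End Optimum.

Unset Implicit Arguments.

Theorem theorem1p3 (R : realType) (F : finFieldType) (n d l : nat) :
  (0 < n)%N -> (0 < d)%N -> (0 < l)%N -> (n <= l)%N ->
  ((ALin F n d)%:R : R)%:E = val_max (PartialKrawtchoukLP_Lin R F n d l).
Proof.
move=> _ _ l0 nl; apply/eqP; rewrite eq_le; apply/andP; split; last first.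
  apply: ge_ereal_sup => _ [a afeas <-]; rewrite lee_fin.
  exact: objective_le_ALin.
have [|C /andP[linC Cd] maxC] := @eq_bigmax_cond _
    [pred C : {set 'rV[F]_n} | linear_code C && mindist_ge d C] (fun C => #|C|).
  (* The zero code shows that the maximum ranges over a nonempty family and so is attained. *)
  apply/card_gt0P; exists [set w | w \in (0%VS : {vspace 'rV[F]_n})].
  rewrite inE linear_code_vspace; apply/forall_inP => w; rewrite inE memv0 => /eqP->.
  rewrite /hweight (_ : [set k | _] = finset.set0) ?cards0 //.
  by apply/finset.setP => k; rewrite !inE mxE eqxx.
rewrite [ALin _ _ _]maxC.
apply: ereal_sup_ubound; exists (code_indicator R C).
  exact: code_indicator_feasible.
by rewrite code_indicator_objective.
Qed.
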